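(* Let $X\in\{0,1\}^{n\times m}$ be a binary matrix with isolation number $i(X)$. For every positive integer $k<i(X)$, the optimal objective value $\zeta_{\text{MLP}}$ of the linear program $\text{MLP}_{\text{exact}}$ (the LP relaxation of $\text{MIP}_{\text{exact}}$ for $X$ and $k$) satisfies $0<\zeta_{\text{MLP}}$.
   Context: For a positive integer $n$ write $[n]=\{1,\dots,n\}$. For $X\in\{0,1\}^{n\times m}$ let $E=\{(i,j)\in[n]\times[m] : x_{ij}=1\}$. Isolation number: a set $S\subseteq E$ is an isolated set of ones of $X$ if whenever $(i_1,j_1),(i_2,j_2)$ are two distinct members of $S$, then (1) $i_1\neq i_2$ and $j_1\neq j_2$, and (2) $x_{i_1,j_2}\,x_{i_2,j_1}=0$. The isolation number $i(X)$ is the largest cardinality of an isolated set of ones of $X$. Let $\mathcal{R}=\{\boldsymbol{a}\boldsymbol{b}^\top : \boldsymbol{a}\in\{0,1\}^n,\ \boldsymbol{b}\in\{0,1\}^m,\ \boldsymbol{a},\boldsymbol{b}\neq\boldsymbol{0}\}$ be the set of all rank-$1$ binary $n\times m$ matrices, enumerated as $\ell=1,\dots,|\mathcal{R}|$. Let $M\in\{0,1\}^{nm\times|\mathcal{R}|}$ be the matrix with rows indexed by $(i,j)\in[n]\times[m]$ and columns indexed by $\ell$, where $M_{(i,j),\ell}$ is the $(i,j)$-th entry of the $\ell$-th matrix of $\mathcal{R}$. Let $M_{\boldsymbol 1}\in\{0,1\}^{|E|\times|\mathcal{R}|}$ consist of the rows of $M$ indexed by $(i,j)\in E$, and $M_{\boldsymbol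 0}\in\{0,1\}^{(nm-|E|)\times|\mathcal{R}|}$ consist of the remaining rows. The integer program $\text{MIP}_{\text{exact}}$ is $$\min\ \boldsymbol{1}^\top\boldsymbol{\xi}+\boldsymbol{1}^\top\boldsymbol{\pi}\quad\text{s.t.}\quad M_{\boldsymbol 1}\boldsymbol{q}+\boldsymbol{\xi}\ge\boldsymbol{1},\quad M_{\boldsymbol 0}\boldsymbol{q}\le k\boldsymbol{\pi},\quad \boldsymbol{1}^\top\boldsymbol{q}\le k,\quad \boldsymbol{\xi}\ge\boldsymbol{0},\quad \boldsymbol{\pi}\in\{0,1\}^{nm-|E|},\quad \boldsymbol{q}\in\{0,1\}^{|\mathcal{R}|},$$ with $\boldsymbol{\xi}\in\mathbb{R}^{|E|}$. Its LP relaxation $\text{MLP}_{\text{exact}}$ is obtained by replacing $\boldsymbol{\pi}\in\{0,1\}^{nm-|E|}$ and $\boldsymbol{q}\in\{0,1\}^{|\mathcal{R}|}$ with $\boldsymbol{\pi}\in[0,1]^{nm-|E|}$ and $\boldsymbol{q}\in[0,1]^{|\mathcal{R}|}$. *)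

(* Defs.v *)
From mathcomp Require Import all_boot all_order all_algebra.
From mathcomp Require Import reals.
Set Implicit Arguments.
Unset Strict Implicit.
Unset Printing Implicit Defensive.
Import Order.TTheory GRing.Theory Num.Theory.

Local Open Scope ring_scope.

(* Binary n x m matrices are 'M[bool]_(n, m), with true for 1, false for 0 and
   && for the product; [n] x [m] is 'I_n * 'I_m, with indices from 0. *)

Definition ones (n m : nat) (X : 'M[bool]_(n, m)) : {set 'I_n * 'I_m} :=
  [set p | X p.1 p.2].

Definition isolated (n m : nat) (X : 'M[bool]_(n, m))
    (S : {set 'I_n * 'I_m}) : bool :=
  (S \subset ones X) &&
  [forall p in S, forall p' in S, (p != p') ==>
    [&& p.1 != p'.1, p.2 != p'.2 & ~~ (X p.1 p'.2 && X p'.1 p.2)]].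

Definition isolation_number (n m : nat) (X : 'M[bool]_(n, m)) : nat :=
  (\max_(S : {set 'I_n * 'I_m} | isolated X S) #|S|)%N.

Definition outer (n m : nat) (a : 'cV[bool]_n) (b : 'cV[bool]_m) :
    'M[bool]_(n, m) :=
  \matrix_(i, j) (a i ord0 && b j ord0).

Definition rank1_binary (n m : nat) : {set 'M[bool]_(n, m)} :=
  [set outer a b | a in [set a : 'cV[bool]_n | a != const_mx false],
                   b in [set b : 'cV[bool]_m | b != const_mx false]].

Definition Mmat (R : realType) (n m : nat) :
    'M[R]_(#|{: 'I_n * 'I_m}|, #|rank1_binary n m|) :=
  \matrix_(p, l) ((enum_val l : 'M[bool]_(n, m))
                    (enum_val p).1 (enum_val p).2)%:R.

Definition Mrows (R : realType) (n m : nat) (A : {set 'I_n * 'I_m}) :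
    'M[R]_(#|A|, #|rank1_binary n m|) :=
  rowsub (fun e : 'I_#|A| => enum_rank (enum_val e)) (Mmat R n m).

Section MLP.
Variables (R : realType) (n m : nat) (X : 'M[bool]_(n, m)) (k : nat).

Definition M1 : 'M[R]_(#|ones X|, #|rank1_binary n m|) := Mrows R (ones X).
Definition M0 : 'M[R]_(#|~: ones X|, #|rank1_binary n m|) :=
  Mrows R (~: ones X).

Definition MLP_feasible (xi : 'cV[R]_#|ones X|) (pi : 'cV[R]_#|~: ones X|)
    (q : 'cV[R]_#|rank1_binary n m|) : Prop :=
  [/\ forall e, 1 <= (M1 *m q + xi) e ord0,
      forall z, (M0 *m q) z ord0 <= k%:R * pi z ord0,
      \sum_l q l ord0 <= k%:R,
      forall e, 0 <= xi e ord0
    & (forall z, 0 <= pi z ord0 <= 1) /\ (forall l, 0 <= q l ord0 <= 1)].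

Definition MLP_objective (xi : 'cV[R]_#|ones X|) (pi : 'cV[R]_#|~: ones X|) :
    R :=
  \sum_e xi e ord0 + \sum_z pi z ord0.

Definition MLP_optimal_value (zeta : R) : Prop :=
  (exists xi pi q, MLP_feasible xi pi q /\ MLP_objective xi pi = zeta) /\
  (forall xi pi q, MLP_feasible xi pi q -> zeta <= MLP_objective xi pi).

End MLP.

(* Main.v *)
Require Import Defs.
From mathcomp Require Import all_boot all_order all_algebra.
From mathcomp Require Import reals.
From mathcomp Require Import boolp classical_sets functions topology normedtype derive.
Import Order.TTheory GRing.Theory Num.Theory.
Import numFieldNormedType.Exports.
Local Open Scope ring_scope.

(** Positivity. A feasible point of objective value zero has [xi = 0] and
    [pi = 0], so its [q] puts total weight at least 1 on the rectangles through
    each one of [X] and weight 0 on every rectangle that meets a zero of [X].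
    The rectangles carrying weight thus lie inside the ones of [X], and such a
    rectangle contains at most one element of an isolated set [S], since it is
    closed under exchanging columns ([card_isolated_in_rank1_le1]). Summing the
    weights over [S] therefore counts each rectangle at most once, so that
    [#|S| <= \sum_l q l <= k] ([card_isolated_le_sum]); for [S] of maximum size
    this contradicts [k < isolation_number X].

    Existence of the optimum. For fixed [q] the best choice of the other
    variables is explicit: [xi] is the positive part of the missing coverage and
    [pi = (M0 *m q) / k], which is at most 1 because the weights sum to at most
    [k]. The program is thus the minimization of the continuous function
    [reduced_objective] over [admissible] vectors [q], which form a compact set,
    so the minimum is attained ([reduced_objective_min]), and it is positive by
    the argument above, applied directly to [reduced_objective]. *)

Section Relaxation.
Set Implicit Arguments.
Unset Strict Implicit.
Variables (R : realType) (n m : nat) (X : 'M[bool]_(n, m)) (k : nat).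

Local Notation N := #|rank1_binary n m|.

Definition weight_at (q : 'cV[R]_N) (p : 'I_n * 'I_m) : R :=
  \sum_(l < N | (enum_val l : 'M[bool]_(n, m)) p.1 p.2) q l ord0.

Definition admissible (q : 'cV[R]_N) : Prop :=
  \sum_l q l ord0 <= k%:R /\ forall l, 0 <= q l ord0 <= 1.

Definition reduced_objective (q : 'cV[R]_N) : R :=
  \sum_(p in ones X) Num.max 0 (1 - weight_at q p)
  + \sum_(p in ~: ones X) k%:R^-1 * weight_at q p.

Lemma reduced_objectiveE (q : 'cV[R]_N) :
  reduced_objective q =
    \sum_(e < #|ones X|) Num.max 0 (1 - weight_at q (enum_val e))
    + \sum_(z < #|~: ones X|) k%:R^-1 * weight_at q (enum_val z).
Proof. by congr (_ + _); rewrite big_enum_val. Qed.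

Lemma mul_MrowsE (A : {set 'I_n * 'I_m}) (q : 'cV[R]_N) (e : 'I_#|A|) :
  (Mrows R A *m q) e ord0 = weight_at q (enum_val e).
Proof.
rewrite mxE [RHS]big_mkcond; apply: eq_bigr => l _.
by rewrite !mxE enum_rankK; case: ifP; rewrite ?mul1r ?mul0r.
Qed.

Lemma weight_at_ge0 (q : 'cV[R]_N) p :
  (forall l, 0 <= q l ord0) -> 0 <= weight_at q p.
Proof. by move=> q0; apply: sumr_ge0. Qed.

Lemma admissible_ge0 (q : 'cV[R]_N) : admissible q -> forall l, 0 <= q l ord0.
Proof. by move=> [_ q01] l; case/andP: (q01 l). Qed.

Lemma weight_at_le (q : 'cV[R]_N) p : admissible q -> weight_at q p <= k%:R.
Proof.
move=> adq; apply: le_trans adq.1.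
rewrite [X in X <= _]big_mkcond; apply: ler_sum => l _.
by case: ifP => // _; exact: admissible_ge0.
Qed.

(** Each constraint bounds one slack variable from below on its own, by the
    corresponding term of the reduced objective. *)
Lemma reduced_objective_le (xi : 'cV[R]_#|ones X|) (pi : 'cV[R]_#|~: ones X|)
    (q : 'cV[R]_N) :
  (0 < k)%N -> MLP_feasible k xi pi q ->
  admissible q /\ reduced_objective q <= MLP_objective xi pi.
Proof.
move=> k0 [h1 h0 qk xi0 [_ q01]]; split=> //.
rewrite reduced_objectiveE; apply: lerD; apply: ler_sum => e _.
  have := h1 e; rewrite mxE mul_MrowsE => h.
  by rewrite ge_max xi0 /= lerBlDl.
by rewrite ler_pdivrMl ?ltr0n // -mul_MrowsE.
Qed.

(** The lower bounds imposed by [q] on the slack variables are themselves a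
    feasible choice; the bound [pi <= 1] is where [\sum_l q l <= k] enters. *)
Lemma reduced_objective_attained (q : 'cV[R]_N) :
  (0 < k)%N -> admissible q ->
  exists (xi : 'cV[R]_#|ones X|) (pi : 'cV[R]_#|~: ones X|),
    MLP_feasible k xi pi q /\ MLP_objective xi pi = reduced_objective q.
Proof.
move=> k0 adq; have [qk q01] := adq.
exists (\col_e Num.max 0 (1 - weight_at q (enum_val e))).
exists (\col_z (k%:R^-1 * weight_at q (enum_val z))).
have kR : 0 < k%:R :> R by rewrite ltr0n.
split; last first.
  rewrite reduced_objectiveE.
  by congr (_ + _); apply: eq_bigr => e _; rewrite mxE.
split=> //.
- by move=> e; rewrite mxE mul_MrowsE mxE -lerBlDl le_max lexx orbT.
- by move=> z; rewrite mul_MrowsE mxE mulVKf ?gt_eqF.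
- by move=> e; rewrite mxE le_max lexx.
split=> // z; rewrite mxE.
rewrite mulr_ge0 ?invr_ge0 ?ler0n ?weight_at_ge0 //=; last exact: admissible_ge0.
by rewrite ler_pdivrMl // mulr1 weight_at_le.
Qed.

Lemma rank1_binary_rectangle (B : 'M[bool]_(n, m)) i j i' j' :
  B \in rank1_binary n m -> B i j -> B i' j' -> B i j' && B i' j.
Proof.
by case/imset2P => a b _ _ ->; rewrite !mxE => /andP[-> ->] /andP[-> ->].
Qed.

(** Two elements of [S] in the rectangle would bring in the two opposite corners
    as well, making both of them ones of [X], which isolation forbids. *)
Lemma card_isolated_in_rank1_le1 (S : {set 'I_n * 'I_m}) (B : 'M[bool]_(n, m)) :
  Defs.isolated X S -> B \in rank1_binary n m ->
  (forall p, p \notin ones X -> ~~ B p.1 p.2) ->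
  (#|[set p in S | B p.1 p.2]| <= 1)%N.
Proof.
move=> /andP[_ /forall_inP isoS] Brk BX; rewrite leqNgt; apply/negP.
move=> /card_gt1P[p [p' [] ]]; rewrite !inE => /andP[pS Bp] /andP[p'S Bp'] pp'.
have /forall_inP/(_ _ p'S)/implyP/(_ pp')/and3P[_ _] := isoS _ pS.
have /andP[B1 B2] := rank1_binary_rectangle Brk Bp Bp'.
apply/negP/negPn/andP; split.
  by apply: contraTT B1 => X1; apply: (BX (p.1, p'.2)); rewrite inE.
by apply: contraTT B2 => X2; apply: (BX (p'.1, p.2)); rewrite inE.
Qed.

(** Double counting of the pairs (element of [S], rectangle containing it),
    weighted by [q]. *)
Lemma card_isolated_le_sum (S : {set 'I_n * 'I_m}) (q : 'cV[R]_N) :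
  Defs.isolated X S -> (forall l, 0 <= q l ord0) ->
  (forall p, p \in ones X -> 1 <= weight_at q p) ->
  (forall p, p \in ~: ones X -> weight_at q p = 0) ->
  #|S|%:R <= \sum_l q l ord0.
Proof.
move=> isoS q0 w1 w0.
have SX : S \subset ones X by case/andP: isoS.
apply: (@le_trans _ _ (\sum_(p in S) weight_at q p)).
  rewrite -sum1_card natr_sum; apply: ler_sum => p pS.
  exact: w1 (fintype.subsetP SX _ pS).
under eq_bigr do rewrite /weight_at big_mkcond.
rewrite exchange_big /=; apply: ler_sum => l _.
rewrite -big_mkcondr /= sumr_const.
(* A rectangle of nonzero weight avoids the zeros of X, so it is counted for at
   most one element of S. *)
have [->|qn0] := eqVneq (q l ord0) 0; first by rewrite mul0rn.
rewrite -[leRHS]mulr1n ler_wpMn2l //.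
have -> : #|[pred p in S | (enum_val l : 'M_(n, m)) p.1 p.2]|
   = #|[set p in S | (enum_val l : 'M_(n, m)) p.1 p.2]|.
  by apply: eq_card => p; rewrite !inE.
apply: card_isolated_in_rank1_le1 => //; first exact: enum_valP.
move=> p pX; apply: contraNN qn0 => lp.
have /w0/eqP : p \in ~: ones X by rewrite finset.in_setC.
by rewrite psumr_eq0 // => /allP/(_ l (mem_index_enum _))/implyP; apply.
Qed.

Lemma reduced_objective_gt0 (q : 'cV[R]_N) :
  (0 < k)%N -> (k < isolation_number X)%N -> admissible q ->
  0 < reduced_objective q.
Proof.
move=> k0 kX adq; have q0 := admissible_ge0 adq.
have kR : 0 < k%:R^-1 :> R by rewrite invr_gt0 ltr0n.
have pos1 : forall p, p \in ones X -> 0 <= Num.max 0 (1 - weight_at q p).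
  by move=> p _; rewrite le_max lexx.
have pos0 : forall p, p \in ~: ones X -> 0 <= k%:R^-1 * weight_at q p.
  by move=> p _; rewrite mulr_ge0 ?weight_at_ge0 ?ltW.
rewrite lt0r addr_ge0 ?sumr_ge0 // andbT.
rewrite paddr_eq0 ?sumr_ge0 // !psumr_eq0 //; apply/negP => /andP[/allP h1 /allP h0].
have [S isoS Smax] : exists2 S, Defs.isolated X S & #|S| = isolation_number X.
  have iso0 : Defs.isolated X finset.set0.
    by rewrite /Defs.isolated finset.sub0set; apply/forall_inP => p; rewrite inE.
  rewrite /isolation_number (bigop.bigmax_eq_arg _ iso0) //.
  by case: arg_maxnP => // S ? _; exists S.
move: kX; rewrite -Smax -(ltr_nat R) ltNge => /negP; apply; apply: le_trans adq.1.
apply: card_isolated_le_sum => // p pX.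
  have /implyP/(_ pX)/eqP/max_idPl := h1 p (mem_index_enum _).
  by rewrite subr_le0.
have /implyP/(_ pX) := h0 p (mem_index_enum _).
by rewrite mulf_eq0 gt_eqF //= => /eqP.
Qed.

Local Open Scope classical_set_scope.

Lemma sum_continuous (T : topologicalType) (I : Type) (r : seq I) (P : pred I)
    (F : I -> T -> R) :
  (forall i, P i -> continuous (F i)) ->
  continuous (fun x => \sum_(i <- r | P i) F i x).
Proof. by apply: continuous_big; exact: add_continuous. Qed.

Lemma sum_coord_continuous (P : pred 'I_N) :
  continuous (fun v : 'rV[R]_N => \sum_(l | P l) v ord0 l).
Proof. by apply: sum_continuous => l _; exact: coord_continuous. Qed.

(** Transposition lets [q] range over row vectors, a space in which
    the product of compact intervals is compact. *)
Lemma reduced_objective_continuous :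
  continuous (fun v : 'rV[R]_N => reduced_objective v^T).
Proof.
have wE v p : weight_at v^T p =
    \sum_(l < N | (enum_val l : 'M[bool]_(n, m)) p.1 p.2) v ord0 l.
  by apply: eq_bigr => l _; rewrite mxE.
have cw p : continuous (fun v : 'rV[R]_N => weight_at v^T p).
  by under eq_fun do rewrite wE; exact: sum_coord_continuous.
have c1 : continuous (fun v : 'rV[R]_N =>
    \sum_(p in ones X) Num.max 0 (1 - weight_at v^T p)).
  apply: sum_continuous => p _ v.
  apply: (@continuous_max _ _ (cst 0) (fun u => 1 - weight_at u^T p)).
    exact: cst_continuous.
  apply: (@continuousB R R^o _ (cst 1) (fun u : 'rV[R]_N => weight_at u^T p)).
    exact: cst_continuous.
  exact: cw.
have c0 : continuous (fun v : 'rV[R]_N =>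
    \sum_(p in ~: ones X) k%:R^-1 * weight_at v^T p).
  apply: sum_continuous => p _ v.
  apply: (@continuousM _ _ (cst k%:R^-1) (fun u : 'rV[R]_N => weight_at u^T p)).
    exact: cst_continuous.
  exact: cw.
move=> v; exact: (@continuousD R R^o _ _ _ v (c1 v) (c0 v)).
Qed.

Lemma admissible_compact : compact [set v : 'rV[R]_N | admissible v^T].
Proof.
have sumE (v : 'rV[R]_N) : \sum_l v^T l ord0 = \sum_l v ord0 l.
  by apply: eq_bigr => l _; rewrite mxE.
have -> : [set v : 'rV[R]_N | admissible v^T] =
    [set v : 'rV[R]_N | forall l, `[0, 1]%classic (v ord0 l)] `&`
    ((fun v : 'rV[R]_N => \sum_l v ord0 l) @^-1` [set x | x <= k%:R]).
  apply/seteqP; split=> v /=; rewrite /admissible /= sumE.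
    by move=> [vk v01]; split=> // l; have := v01 l; rewrite mxE in_itv.
  by move=> [v01 vk]; split=> // l; have := v01 l; rewrite mxE in_itv.
apply: compact_closedI.
  apply: (@rV_compact R N (fun=> `[0%R, 1%R]%classic)) => l.
  exact: segment_compact.
apply: closed_comp => [v _|]; [exact: sum_coord_continuous | exact: closed_le].
Qed.

Lemma reduced_objective_min :
  exists2 q, admissible q &
    forall q', admissible q' -> reduced_objective q <= reduced_objective q'.
Proof.
have nonempty : [set v : 'rV[R]_N | admissible v^T] !=set0.
  exists 0; split=> [|l]; last by rewrite !mxE lexx ler01.
  by rewrite big1 ?ler0n // => l _; rewrite !mxE.
have [v] := compact_EVT_min nonempty admissible_compact
  (continuous_subspaceT reduced_objective_continuous).
rewrite inE => adv minv; exists v^T => // q' adq'.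
by rewrite -[q']trmxK; apply: minv; rewrite inE /= trmxK.
Qed.

End Relaxation.

Theorem lemma2 (R : realType) (n m : nat) (X : 'M[bool]_(n, m)) (k : nat)
    (hk0 : (0 < k)%N) (hk : (k < isolation_number X)%N) :
  exists zeta : R, MLP_optimal_value X k zeta /\ 0 < zeta.
Proof.
have [q adq qmin] := reduced_objective_min R X k.
exists (reduced_objective X k q); split; last exact: reduced_objective_gt0.
split.
  have [xi [pi [feas obj]]] := reduced_objective_attained X hk0 adq.
  by exists xi, pi, q.
move=> xi pi q' /(reduced_objective_le hk0)[adq' le_obj].
exact: le_trans (qmin _ adq') le_obj.
Qed.
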